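(* Let $k\geq 2$, let $G_l(q)$ ($l\geq 1$) and ${}^J_ih^{(j)}_1(q)$ be as in the context. Then for every $J\geq 0$ and every $i\in\{1,\dots,k\}$ the limit $\lim_{j\to\infty}{}^J_ih^{(j)}_1(q)$ exists, and $$G_{(k-1)J+i}(q)=\lim_{j\to\infty}{}^J_ih^{(j)}_1(q).$$
   Context: $q$ is a formal variable. Fix an integer $k\geq 2$. For $1\leq i\leq k$ define $$G_i(q)=\prod_{\substack{m\geq 1,\ m\not\equiv 2\ (\mathrm{mod}\ 4),\\ m\not\equiv 0,\ 2k+(2i-1),\ 2k-(2i-1)\ (\mathrm{mod}\ 4k)}}(1-q^m)^{-1}.$$ Every integer $l\geq k+1$ can be written uniquely as $l=(k-1)j+i$ with $j\geq 1$ and $2\leq i\leq k$ (note $(k-1)j+1=(k-1)(j-1)+k$). For such $l$ define recursively $$G_{(k-1)j+i}(q)=\frac{G_{(k-1)(j-1)+k-i+1}(q)-G_{(k-1)(j-1)+k-i+2}(q)}{q^{2j(i-1)}}-q^{-1}G_{(k-1)j+i-1}(q).$$ For each $j\geq 1$ let $\mathbf{A}'_{(j)}$ be the $k\times k$ matrix with $(r,c)$ entry $[c\leq k-r+1]\,q^{2j(c-1)}+[c\leq k-r]\,q^{2jc-1}$ ($[P]$ is $1$ if $P$ holds, $0$ otherwise). For an integer $J\geq 0$ let ${}^J\mathbf{h}^{(J)}$ be the identity matrix and ${}^J\mathbf{h}^{(j)}=\mathbf{A}'_{(J+1)}\cdots\mathbf{A}'_{(j)}$ for $j>J$; let ${}^J_ih^{(j)}_l(q)$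 be its $(i,l)$ entry. A sequence $H_j(q)$ of formal power series has a limit if for every $t\geq 0$ the coefficient of $q^t$ in $H_j(q)$ is independent of $j$ for all sufficiently large $j$; the limit is the power series whose coefficient of $q^t$ is this stable value. *)

(* Defs.v *)
From HB Require Import structures.
From mathcomp Require Import all_boot all_order all_algebra.
From mathcomp Require Import zify boolp.

Set Implicit Arguments.
Unset Strict Implicit.
Unset Printing Implicit Defensive.
Set Warnings "-redundant-canonical-projection".

Import Order.TTheory GRing.Theory Num.Theory.
Local Open Scope ring_scope.

(* The ring Z[[q]]; [f t] is the coefficient of q^t.  Decidable equality and
   choice are classical. *)
Record fps := FPS { fcoef :> nat -> int }.

HB.instance Definition _ := gen_eqMixin fps.
HB.instance Definition _ := gen_choiceMixin fps.

Lemma fpsP (f g : fps) : (forall t, f t = g t) <-> f = g.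
Proof.
split=> [|-> //]; case: f g => [f] [g] /= fg.
by congr FPS; apply/funext.
Qed.

Definition fps_zero := FPS (fun _ => 0).
Definition fps_one := FPS (fun t => (t == 0%N)%:R).
Definition fps_opp (f : fps) := FPS (fun t => - f t).
Definition fps_add (f g : fps) := FPS (fun t => f t + g t).
Definition fps_mul (f g : fps) :=
  FPS (fun t => \sum_(s < t.+1) f s * g (t - s)%N).

Lemma fps_addA : associative fps_add.
Proof. by move=> f g h; apply/fpsP => t /=; rewrite addrA. Qed.
Lemma fps_addC : commutative fps_add.
Proof. by move=> f g; apply/fpsP => t /=; rewrite addrC. Qed.
Lemma fps_add0 : left_id fps_zero fps_add.
Proof. by move=> f; apply/fpsP => t /=; rewrite add0r. Qed.
Lemma fps_addN : left_inverse fps_zero fps_opp fps_add.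
Proof. by move=> f; apply/fpsP => t /=; rewrite addNr. Qed.

HB.instance Definition _ :=
  GRing.isZmodule.Build fps fps_addA fps_addC fps_add0 fps_addN.

Definition fps_trunc n (f : fps) : {poly int} := \poly_(s < n.+1) f s.

Lemma coef_fps_trunc n f t : (t <= n)%N -> (fps_trunc n f)`_t = f t.
Proof. by move=> tn; rewrite coef_poly ltnS tn. Qed.

Lemma coef_fps_mul n f g t : (t <= n)%N ->
  fps_mul f g t = (fps_trunc n f * fps_trunc n g)`_t.
Proof.
move=> tn; rewrite coefM; apply: eq_bigr => s _.
rewrite !coef_fps_trunc ?(leq_trans _ tn) ?leq_subr //.
by rewrite -ltnS ltn_ord.
Qed.

Lemma fps_mulC : commutative fps_mul.
Proof.
by move=> f g; apply/fpsP => t; rewrite !(coef_fps_mul _ _ (leqnn t)) mulrC.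
Qed.

Lemma fps_mulA : associative fps_mul.
Proof.
move=> f g h; apply/fpsP => t.
suff E a b c : fps_mul (fps_mul a b) c t
    = (fps_trunc t a * fps_trunc t b * fps_trunc t c)`_t.
  by rewrite [LHS](congr1 (fun x : fps => x t) (fps_mulC _ _)) !E mulrC mulrA.
rewrite (coef_fps_mul _ _ (leqnn t)) !coefM; apply: eq_bigr => s _.
have st : (s <= t)%N by rewrite -ltnS ltn_ord.
by rewrite coef_fps_trunc // (coef_fps_mul _ _ st) -(coef_fps_mul _ _ st)
           (coef_fps_mul _ _ st).
Qed.

Lemma fps_mul1 : left_id fps_one fps_mul.
Proof.
move=> f; apply/fpsP => t /=; rewrite big_ord_recl /= mul1r subn0 big1 ?addr0 //.
by move=> s _; rewrite mul0r.
Qed.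

Lemma fps_mulD : left_distributive fps_mul fps_add.
Proof.
move=> f g h; apply/fpsP => t /=; rewrite -big_split /=.
by apply: eq_bigr => s _; rewrite mulrDl.
Qed.

Lemma fps_1neq0 : fps_one != 0.
Proof. by apply/eqP => /fpsP/(_ 0%N). Qed.

HB.instance Definition _ := GRing.Zmodule_isComNzRing.Build fps
  fps_mulA fps_mulC fps_mul1 fps_mulD fps_1neq0.

Lemma fcoef0 t : (0 : fps) t = 0. Proof. by []. Qed.
Lemma fcoef1 t : (1 : fps) t = (t == 0%N)%:R. Proof. by []. Qed.
Lemma fcoefN (f : fps) t : (- f) t = - f t. Proof. by []. Qed.
Lemma fcoefD (f g : fps) t : (f + g) t = f t + g t. Proof. by []. Qed.
Lemma fcoefB (f g : fps) t : (f - g) t = f t - g t. Proof. by []. Qed.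
Lemma fcoefM (f g : fps) t :
  (f * g) t = \sum_(s < t.+1) f s * g (t - s)%N.
Proof. by []. Qed.

Lemma fcoef_sum I (r : seq I) (P : pred I) (F : I -> fps) t :
  (\sum_(x <- r | P x) F x) t = \sum_(x <- r | P x) F x t.
Proof. by elim/big_rec2: _ => // x y f _ <-. Qed.

Lemma eq_fcoefM (f f' g g' : fps) t :
    (forall s, (s <= t)%N -> f s = f' s) ->
    (forall s, (s <= t)%N -> g s = g' s) ->
  (f * g) t = (f' * g') t.
Proof.
move=> ff gg; rewrite !fcoefM; apply: eq_bigr => s _.
by rewrite ff ?gg ?leq_subr // -ltnS ltn_ord.
Qed.

Lemma fcoefX_lt (f : fps) n t : f 0%N = 0 -> (t < n)%N -> (f ^+ n) t = 0.
Proof.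
move=> f0; elim: n t => // n IHn t tn; rewrite exprS fcoefM big1 // => s _.
have [-> | s0] := posnP s; first by rewrite f0 mul0r.
by have sn := ltn_ord s; rewrite IHn ?mulr0 //; lia.
Qed.

(* A series is a unit iff its constant term u is, with inverse
   u^-1 * \sum_n (1 - u^-1 f)^n. *)
Definition fps_const (a : int) := FPS (fun t => if t == 0%N then a else 0).

Definition fps_unit : {pred fps} := fun f => f 0%N \is a GRing.unit.

Definition fps_inv (f : fps) : fps :=
  let u := fps_const (f 0%N)^-1 in
  if fps_unit f then u * FPS (fun t => (\sum_(n < t.+1) (1 - u * f) ^+ n) t)
  else f.

Lemma fcoefM0 (f g : fps) : (f * g) 0%N = f 0%N * g 0%N.
Proof. by rewrite fcoefM big_ord1. Qed.

Lemma fps_geomP (g : fps) : g 0%N = 0 ->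
  FPS (fun t => (\sum_(n < t.+1) g ^+ n) t) * (1 - g) = 1.
Proof.
move=> g0; apply/fpsP => t.
have -> : (FPS (fun t => (\sum_(n < t.+1) g ^+ n) t) * (1 - g)) t
    = ((\sum_(n < t.+1) g ^+ n) * (1 - g)) t.
  apply: eq_fcoefM => // s st; rewrite [LHS]fcoef_sum fcoef_sum.
  rewrite (@big_ord_widen _ _ _ s.+1 t.+1 (fun n => (g ^+ n) s)) //.
  rewrite [RHS](bigID (fun n : 'I__ => (n < s.+1)%N)) /=.
  rewrite [X in _ = _ + X]big1 ?addr0 // => n.
  by rewrite -leqNgt => /(fcoefX_lt g0).
by rewrite mulrC -opprB mulNr -subrX1 opprB fcoefB (fcoefX_lt g0) ?subr0.
Qed.

Lemma fps_mulVx : {in fps_unit, left_inverse 1 fps_inv *%R}.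
Proof.
move=> f uf; have uf0 : f 0%N \is a GRing.unit by [].
rewrite /fps_inv [fps_unit f]uf; set u := fps_const _.
have := @fps_geomP (1 - u * f); rewrite subKr => E.
by rewrite mulrAC mulrC E // fcoefB fcoefM0 /= mulVr ?subrr.
Qed.

Lemma fps_unitPl (f g : fps) : g * f = 1 -> fps_unit f.
Proof.
move=> /fpsP/(_ 0%N); rewrite fcoefM0 => gf.
by apply/unitrP; exists (g 0%N); rewrite gf mulrC gf.
Qed.

Lemma fps_inv_out : {in [predC fps_unit], fps_inv =1 id}.
Proof. by move=> f /negPf nf; rewrite /fps_inv [fps_unit f]nf. Qed.

HB.instance Definition _ := GRing.ComNzRing_hasMulInverse.Build fps
  fps_mulVx fps_unitPl fps_inv_out.

Lemma fps_val_ex (f : fps) : f != 0 ->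
  exists2 n, f n != 0 & forall s, (s < n)%N -> f s = 0.
Proof.
move=> f0; have [|ex0] := pselect (exists n, f n != 0).
  move=> ex; case: (ex_minnP ex) => n fn min_n; exists n => // s sn.
  by apply/eqP; apply: contraLR sn => /min_n; rewrite leqNgt.
case/eqP: f0; apply/fpsP => t; apply/eqP; rewrite fcoef0.
by apply: contrapT => ft; apply: ex0; exists t; apply/negP.
Qed.

Lemma fps_idomain : GRing.integral_domain_axiom fps.
Proof.
move=> f g fg0; apply: contraT; rewrite negb_or => /andP[/fps_val_ex[a fa ltfa] /fps_val_ex[b gb ltgb]].
have /fpsP/(_ (a + b)%N) := fg0; have ab : (a < (a + b).+1)%N by rewrite ltnS leq_addr.
rewrite fcoefM (bigD1 (Ordinal ab)) //= addKn big1 ?addr0.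
  by move/eqP; rewrite mulf_eq0 (negPf fa) (negPf gb).
move=> s; rewrite -val_eqE /= neq_ltn => /orP[/ltfa-> | sa]; first exact: mul0r.
have sab := ltn_ord s; rewrite [g _]ltgb ?mulr0 //; lia.
Qed.

HB.instance Definition _ := GRing.ComUnitRing_isIntegral.Build fps fps_idomain.

Definition fps_q : fps := FPS (fun t => (t == 1%N)%:R).

Definition fps_cvg (H : nat -> fps) (L : fps) : Prop :=
  forall t, exists N, forall j, (N <= j)%N -> H j t = L t.

Lemma fps_cvg_unique H L L' : fps_cvg H L -> fps_cvg H L' -> L = L'.
Proof.
move=> HL HL'; apply/fpsP => t; have [N E] := HL t; have [N' E'] := HL' t.
by rewrite -(E (maxn N N')) ?leq_maxl // E' ?leq_maxr.
Qed.

Lemma fps_cvgP (H : nat -> fps) :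
  (exists L, fps_cvg H L) <->
  (forall t, exists N, forall j j', (N <= j)%N -> (N <= j')%N -> H j t = H j' t).
Proof.
split=> [[L HL] t | st].
  by have [N E] := HL t; exists N => j j' /E-> /E->.
have [N E] := choice st; exists (FPS (fun t => H (N t) t)) => t.
by exists (N t) => j Nj /=; apply: E.
Qed.

Definition admissible (k i m : nat) : bool :=
  [&& m != 2 %[mod 4],
      m != 0 %[mod 4 * k],
      m != 2 * k + (2 * i - 1) %[mod 4 * k]
    & m != 2 * k - (2 * i - 1) %[mod 4 * k]]%N.

Definition Gpartial (k i n : nat) : fps :=
  \prod_(1 <= m < n | admissible k i m) (1 - fps_q ^+ m)^-1.

(* The infinite product: factors with m > t do not affect the coefficient of
   q^t, see [Gprod_cvg]. *)
Definition Gprod (k i : nat) : fps := FPS (fun t => Gpartial k i t.+1 t).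

Lemma fcoef_qX n t : (fps_q ^+ n) t = (t == n)%:R.
Proof.
elim: n t => // n IHn t; rewrite exprS fcoefM.
case: t => [|t]; first by rewrite big_ord1 mul0r.
rewrite 2!big_ord_recl /= mul0r add0r mul1r IHn subn1 /= big1 ?addr0 //.
by move=> s _; rewrite mul0r.
Qed.

Lemma fcoefM_eq0 (f g : fps) t n : (t < n)%N ->
  (forall s, (s < n)%N -> f s = 0) -> (f * g) t = 0.
Proof.
move=> tn f0; rewrite fcoefM big1 // => s _.
by rewrite f0 ?mul0r // (leq_trans _ tn).
Qed.

Lemma unit_1BqX n : (0 < n)%N -> 1 - fps_q ^+ n \is a GRing.unit.
Proof.
move=> n0; rewrite unfold_in /= /fps_unit fcoefB fcoef_qX fcoef1 eq_sym.
by rewrite (gtn_eqF n0) subr0 unitr1.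
Qed.

Lemma Gprod_cvg k i : fps_cvg (Gpartial k i) (Gprod k i).
Proof.
move=> t; exists t.+1; elim=> // n IHn.
rewrite leq_eqVlt => /predU1P[<- // | ]; rewrite ltnS => tn.
have n0 : (0 < n)%N by apply: leq_trans tn.
have -> : Gpartial k i n.+1 = Gpartial k i n
    * (if admissible k i n then (1 - fps_q ^+ n)^-1 else 1).
  by rewrite /Gpartial big_mkcond big_nat_recr //= -big_mkcond.
rewrite -[RHS]IHn //; case: ifP => _; last by rewrite mulr1.
have -> : (1 - fps_q ^+ n)^-1 = 1 + fps_q ^+ n * (1 - fps_q ^+ n)^-1.
  apply: (mulIr (unit_1BqX n0)).
  by rewrite mulrDl -mulrA !mulVr ?unit_1BqX // mulr1 mul1r subrK.
rewrite mulrDr mulr1 mulrCA fcoefD (@fcoefM_eq0 _ _ _ n) ?addr0 // => s sn.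
by rewrite fcoef_qX (ltn_eqF sn).
Qed.

Notation qF := (FracField.tofrac fps_q).

(* [Gblock k j i] is G_{(k-1)j+i} for 1 <= i <= k.  The division by powers of q
   takes place in the fraction field of Z[[q]]. *)
Fixpoint Gblock (k j i : nat) {struct j} : {fraction fps} :=
  match j with
  | 0 => FracField.tofrac (Gprod k i)
  | j'.+1 =>
    (fix block i := match i with
     | 0 => 0
     | 1 => Gblock k j' k
     | i'.+1 => (Gblock k j' (k - i + 1) - Gblock k j' (k - i + 2))
                  / qF ^+ (2 * j * (i - 1)) - qF^-1 * block i'
     end) i
  end.

(* For l > k, l = (k-1)j + i with 2 <= i <= k exactly when l - 2 = (k-1)j + (i-2)
   is the Euclidean division of l - 2 by k - 1. *)
Definition G (k l : nat) : {fraction fps} :=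
  if (l <= k)%N then FracField.tofrac (Gprod k l)
  else Gblock k ((l - 2) %/ (k - 1)) ((l - 2) %% (k - 1) + 2).

Lemma G_init k i : (1 <= i <= k)%N -> G k i = FracField.tofrac (Gprod k i).
Proof. by case/andP=> _ ik; rewrite /G ik. Qed.

Lemma GblockE k j i : (2 <= k)%N -> (1 <= i <= k)%N ->
  G k ((k - 1) * j + i) = Gblock k j i.
Proof.
move=> k2; have P j' i' : (2 <= i' <= k)%N ->
    G k ((k - 1) * j' + i') = Gblock k j' i'.
  case/andP=> i2 ik; case: j' => [|j']; first by rewrite muln0 add0n /G ik.
  rewrite /G ifF; last by apply/negbTE; nia.
  have -> : ((k - 1) * j'.+1 + i' - 2 = j'.+1 * (k - 1) + (i' - 2))%N by nia.
  have ltk : (i' - 2 < k - 1)%N by lia.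
  rewrite divnMDl ?modnMDl ?divn_small ?modn_small ?addn0 ?subnK //; lia.
case/andP; case: i => [|[|i]] // _ ik; last by apply: P.
case: j => [|j]; first by rewrite muln0 /G ik.
have -> : ((k - 1) * j.+1 + 1 = (k - 1) * j + k)%N by nia.
by rewrite P ?k2 /=.
Qed.

Lemma G_rec k j i : (2 <= k)%N -> (1 <= j)%N -> (2 <= i <= k)%N ->
  G k ((k - 1) * j + i) =
    (G k ((k - 1) * (j - 1) + k - i + 1) - G k ((k - 1) * (j - 1) + k - i + 2))
      / qF ^+ (2 * j * (i - 1))
    - qF^-1 * G k ((k - 1) * j + i - 1).
Proof.
move=> k2; case: j => // j _ /andP[i2 ik]; rewrite [(j.+1 - 1)%N]subn1 [j.+1.-1]/=.
have -> : ((k - 1) * j + k - i + 1 = (k - 1) * j + (k - i + 1))%N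
  by rewrite addnA addnBA.
have -> : ((k - 1) * j + k - i + 2 = (k - 1) * j + (k - i + 2))%N
  by rewrite addnA addnBA.
have -> : ((k - 1) * j.+1 + i - 1 = (k - 1) * j.+1 + (i - 1))%N
  by rewrite addnBA // ltnW.
rewrite !GblockE //; try lia.
by case: i i2 ik => [|[|i]] // i2 ik; rewrite [(i.+2 - 1)%N]subn1.
Qed.

(* r.+1 and c.+1 are the 1-based row and column indices of the formula. *)
Definition A' (k j : nat) : 'M[fps]_k :=
  \matrix_(r < k, c < k)
    (((c.+1 <= k - r.+1 + 1)%N)%:R * fps_q ^+ (2 * j * (c.+1 - 1))
     + ((c.+1 <= k - r.+1)%N)%:R * fps_q ^+ (2 * j * c.+1 - 1)).

(* A'_(J+1) *m ... *m A'_(j), which is the identity for j = J. *)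
Definition h (k J j : nat) : 'M[fps]_k :=
  \big[mulmx/1%:M]_(J.+1 <= s < j.+1) A' k s.

(* Main.v *)
(* The recursion says that the column (G_{(k-1)j+i})_i equals A'_(j+1) times the
   column (G_{(k-1)(j+1)+i})_i, so the column at level J is h^(j) times the column
   at level j.  The columns of h^(j) other than the first are O(q^j), so the
   theorem follows once every G_{(k-1)j+i} is known to be a power series and
   G_{(k-1)j+1} to tend to 1.  Both come from a closed form, Andrews' J-series at
   x = q^(2j), divided by the Euler product over m <> 2 (mod 4).  At j = 0 the
   closed form is the theta series that the Jacobi triple product identifies with
   the given infinite product; the recursion is checked termwise after a shift of
   the summation index. *)

Require Import Defs.
From HB Require Import structures.
From mathcomp Require Import all_boot all_order all_algebra.
From mathcomp Require Import zify ring.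

Set Implicit Arguments.
Unset Strict Implicit.
Unset Printing Implicit Defensive.

Import Order.TTheory GRing.Theory Num.Theory.
Local Open Scope ring_scope.

Local Notation q := fps_q.

(** * A finite form of the Jacobi triple product *)

Section FiniteTripleProduct.
Variable R : comNzRingType.
Implicit Types Q u y a b : R.

(** The Gaussian binomial coefficient, given by its Pascal rule so that no division is involved. For
    n' < m' the truncated exponent is harmless, since it multiplies a zero coefficient. *)
Fixpoint gauss Q (n m : nat) : R :=
  match n, m with
  | _, 0 => 1
  | 0, _.+1 => 0
  | n'.+1, m'.+1 => gauss Q n' m + Q ^+ (n' - m') * gauss Q n' m'
  end.

Lemma gauss0 Q n : gauss Q n 0 = 1.
Proof. by case: n. Qed.

Lemma gauss_small Q n m : (n < m)%N -> gauss Q n m = 0.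
Proof.
elim: n m => [|n IHn] [|m] //= nm.
by rewrite !IHn ?mulr0 ?addr0 //; lia.
Qed.

Definition qpoch Q n : R := \prod_(m < n) (1 - Q ^+ m.+1).

Lemma qpochS Q n : qpoch Q n.+1 = qpoch Q n * (1 - Q ^+ n.+1).
Proof. by rewrite /qpoch big_ord_recr. Qed.

(** Induction on n + m: the two terms of the Pascal rule contribute the two parts of 1 - Q^(n+m+1) =
    (1 - Q^n) + Q^n (1 - Q^(m+1)). *)
Lemma gauss_qpoch Q n m :
  gauss Q (n + m) m * (qpoch Q m * qpoch Q n) = qpoch Q (n + m).
Proof.
have [N] := ubnP (n + m); elim: N n m => // N IHN n [|m] lt_nm.
  by rewrite gauss0 addn0 /qpoch big_ord0 !mul1r.
rewrite addnS /= mulrDl (qpochS Q (n + m)); have -> : (n + m - m = n)%N by lia.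
have E2 : gauss Q (n + m) m * (qpoch Q m * qpoch Q n) = qpoch Q (n + m).
  by apply: IHN; lia.
rewrite [X in _ + X](_ : _ = Q ^+ n * (1 - Q ^+ m.+1) * qpoch Q (n + m));
  last by rewrite -E2 qpochS; ring.
case: n lt_nm {E2} => [|n] lt_nm.
  by rewrite gauss_small // mul0r add0r add0n expr0; ring.
have E1 : gauss Q (n.+1 + m) m.+1 * (qpoch Q m.+1 * qpoch Q n) = qpoch Q (n.+1 + m).
  by rewrite addSnnS; apply: IHN; lia.
by rewrite [qpoch Q n.+1]qpochS -E1 -addnS exprD; ring.
Qed.

(** Cauchy's q-binomial theorem, homogeneous in u and y so that u can later be a power of Q and no
    negative exponent arises. *)
Lemma qbinomial Q u y n :
  \prod_(m < n) (u + y * Q ^+ m) =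
  \sum_(m < n.+1) gauss Q n m * Q ^+ 'C(m, 2) * y ^+ m * u ^+ (n - m).
Proof.
elim: n => [|n IHn]; first by rewrite big_ord0 big_ord1 /= !mulr1.
rewrite big_ord_recr /= IHn mulrDr [RHS]big_ord_recl /=.
(* By the Pascal rule, the term of index m + 1 splits into the contributions of u and of y Q^n from
   the last factor. *)
rewrite [X in _ = _ + X](eq_bigr (fun m : 'I_n.+1 =>
    gauss Q n m.+1 * Q ^+ 'C(m.+1, 2) * y ^+ m.+1 * u ^+ (n - m)
  + gauss Q n m * Q ^+ 'C(m, 2) * y ^+ m * u ^+ (n - m) * (y * Q ^+ n))); last first.
  move=> m _; rewrite /bump /= add1n subSS mulrDl mulrDl mulrDl; congr (_ + _).
  have /(congr1 (fun e => Q ^+ e)) :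
    (n - m + 'C(m.+1, 2) = n + 'C(m, 2))%N by rewrite binS bin1; have := ltn_ord m; lia.
  by rewrite !exprD exprS => E; ring: E.
rewrite big_split /= addrA -mulr_suml; congr (_ + _).
rewrite big_ord_recl [X in _ = _ + X]big_ord_recr /= (gauss_small _ (leqnn _)).
rewrite !mul0r addr0 mulrDl gauss0.
congr (_ + _); first by rewrite subn0 exprSr; ring.
rewrite mulr_suml; apply: eq_bigr => m _.
rewrite /bump /= add1n -mulrA -exprSr.
by congr (_ * u ^+ _); have := ltn_ord m; lia.
Qed.

End FiniteTripleProduct.

Lemma mulCbin2 n : ('C(n, 2) + 'C(n, 2) + n = n * n)%N.
Proof. by elim: n => // n; rewrite binS bin1; lia. Qed.

(** With N = r + n, this and [bin2_triple_high] compute the exponents of Q at the indices N - n and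
    N + n + 1 of the q-binomial expansion below: both exceed that of the prefactor by C(n+1, 2). *)
Lemma bin2_triple_low r n :
  ('C(r, 2) + (r + n) * (r + n + (r + n).+1 - r) =
   'C(r + n, 2) + (r + n) * (r + n).+1 + ('C(n, 2) + n))%N.
Proof.
have Crn := mulCbin2 (r + n); have Cr := mulCbin2 r; have Cn := mulCbin2 n.
have -> : (r + n + (r + n).+1 - r = r + n + n + 1)%N by clear; lia.
by lia.
Qed.

Lemma bin2_triple_high r n :
  ('C((r + n + n).+1, 2) + (r + n) * (r + n + (r + n).+1 - (r + n + n).+1) =
   'C(r + n, 2) + (r + n) * (r + n).+1 + ('C(n, 2) + n))%N.
Proof.
have Crnn := mulCbin2 (r + n + n).+1; have Crn := mulCbin2 (r + n); have Cn := mulCbin2 n.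
have -> : (r + n + (r + n).+1 - (r + n + n).+1 = r)%N by clear; lia.
by lia.
Qed.

(** The q-binomial theorem for the 2N + 1 factors Q^N - b Q^m, where Q = ab. A factor with m < N is
    -b Q^m (1 - a Q^(N-1-m)), the others are Q^N (1 - b Q^(m-N)). In the sum, the terms at N - n and
    N + 1 + n have the same Gaussian coefficient and are paired. *)
Lemma finite_triple_product (R : idomainType) (a b : R) N :
    a != 0 -> b != 0 ->
    (forall n, qpoch (a * b) n != 0) ->
  \prod_(m < N) (1 - a * (a * b) ^+ m) * \prod_(m < N.+1) (1 - b * (a * b) ^+ m) =
  \sum_(n < N.+1) gauss (a * b) (N + N.+1) (N - n) * ((-1) ^+ n
    * a ^+ 'C(n.+1, 2) * b ^+ 'C(n, 2) * (1 - b ^+ (2 * n).+1)).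
Proof.
move=> a0 b0 qpoch0; set Q := a * b in qpoch0 *.
have gauss_sym n : (n <= N)%N ->
    gauss Q (N + N.+1) (N.+1 + n) = gauss Q (N + N.+1) (N - n).
  move=> nN; apply: (mulIf (mulf_neq0 (qpoch0 (N.+1 + n)%N) (qpoch0 (N - n)%N))).
  rewrite -{1}[(N + N.+1)%N](_ : (N - n + (N.+1 + n) = _)%N) ?gauss_qpoch; last by lia.
  rewrite [X in _ = _ * X]mulrC -[in RHS](_ : (N.+1 + n + (N - n) = N + N.+1)%N).
    by rewrite gauss_qpoch; congr qpoch; lia.
  by lia.
(* [c] is the product of all monomials pulled out of the 2N + 1 factors. *)
pose c := (- b) ^+ N * Q ^+ ('C(N, 2) + N * N.+1).
have c0 : c != 0 by rewrite mulf_neq0 // expf_neq0 ?oppr_eq0 ?mulf_neq0.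
apply: (mulfI c0); transitivity (\prod_(m < N + N.+1) (Q ^+ N + (- b) * Q ^+ m)).
  symmetry; rewrite big_split_ord /= (reindex_inj rev_ord_inj) /=.
  rewrite (eq_bigr (fun m : 'I_N => ((- b) * Q ^+ (N - m.+1)) * (1 - a * Q ^+ m))); last first.
    move=> m _; rewrite mulrDr mulr1 addrC; congr (_ + _).
    have /(congr1 (fun e => Q ^+ e)) : (N = N - m.+1 + m + 1)%N by have := ltn_ord m; lia.
    by rewrite !exprD expr1 {4}/Q => ->; ring.
  rewrite [X in _ * X](eq_bigr (fun m : 'I_N.+1 => Q ^+ N * (1 - b * Q ^+ m))); last first.
    by move=> m _; rewrite exprD; ring.
  rewrite !big_split /= !prodr_const !card_ord.
  have -> : \prod_(m < N) Q ^+ (N - m.+1) = Q ^+ 'C(N, 2).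
    rewrite prodrXr; congr (_ ^+ _).
    rewrite -(big_mkord xpredT (fun m => N - m.+1)%N) big_nat_rev /= -bin2_sum.
    by rewrite !big_mkord; apply: eq_bigr => m _; have := ltn_ord m; lia.
  by rewrite /c exprD exprM; ring.
rewrite qbinomial -addSn big_split_ord /= (reindex_inj rev_ord_inj) /= -big_split /=.
rewrite mulr_sumr; apply: eq_bigr => n _; have nN := ltn_ord n.
rewrite subSS gauss_sym // mulrCA !addSn -!mulrA -mulrDr; congr (_ * _).
move: (nat_of_ord n) nN => {}n nN; have Cn1 : ('C(n.+1, 2) = 'C(n, 2) + n)%N by rewrite binS bin1.
rewrite -!exprM [X in X + _]mulrCA [X in _ + X]mulrCA -!exprD.
have {}nN : (n <= N)%N by [].
have [r E] : exists r, N = (r + n)%N by exists (N - n)%N; clear -nN; lia.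
have -> : ('C(N - n, 2) + N * (N + N.+1 - (N - n)) = 'C(N, 2) + N * N.+1 + 'C(n.+1, 2))%N.
  by rewrite Cn1 E addnK; apply: bin2_triple_low.
have -> : ('C((N + n).+1, 2) + N * (N + N.+1 - (N + n).+1) =
    'C(N, 2) + N * N.+1 + 'C(n.+1, 2))%N.
  by rewrite Cn1 E; apply: bin2_triple_high.
have -> : (- b) ^+ N = (- b) ^+ (N - n) * ((-1) ^+ n * b ^+ n).
  by rewrite -exprNn -exprD subnK.
have -> : (- b) ^+ (N + n).+1 = (- b) ^+ (N - n) * (- (b ^+ (2 * n).+1)).
  have -> : (- b) ^+ (N + n).+1 = (- b) ^+ (N - n) * (- b) ^+ (2 * n).+1.
    by rewrite -exprD; congr (_ ^+ _); clear -nN; lia.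
  by rewrite [(- b) ^+ (2 * n).+1]exprNn -signr_odd /= oddM expr1 mulN1r.
rewrite exprD; have -> : Q ^+ 'C(n.+1, 2) = a ^+ 'C(n.+1, 2) * (b ^+ 'C(n, 2) * b ^+ n).
  by rewrite exprMn -exprD Cn1.
have ss : (-1) ^+ n * (-1) ^+ n = 1 :> R by rewrite -exprMn mulrNN mul1r expr1n.
move: (_ ^+ (N - n)) (Q ^+ _) ((-1) ^+ n) ss => B W s ss.
move: (b ^+ n) (b ^+ (2 * n).+1) (b ^+ 'C(n, 2)) (a ^+ _) => y z v u.
transitivity (s * s * (B * W * u * v * y * (1 - z))); last by ring.
by rewrite ss; ring.
Qed.

(** * Infinite sums and products of power series *)

(** Congruence modulo q^T; identities between infinite sums and products are proved modulo every
    q^T. *)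
Definition eqmod T (f g : fps) := forall t, (t < T)%N -> f t = g t.

Lemma eqmod_refl T f : eqmod T f f. Proof. by []. Qed.
#[local] Hint Resolve eqmod_refl : core.

Lemma eqmod_sym T f g : eqmod T f g -> eqmod T g f.
Proof. by move=> fg t tT; rewrite fg. Qed.

Lemma eqmod_trans T g f h : eqmod T f g -> eqmod T g h -> eqmod T f h.
Proof. by move=> fg gh t tT; rewrite fg // gh. Qed.

Lemma eqmodW T S f g : (S <= T)%N -> eqmod T f g -> eqmod S f g.
Proof. by move=> ST fg t tS; apply: fg; apply: leq_trans tS ST. Qed.

Lemma eqmod_eq f g : (forall T, eqmod T f g) -> f = g.
Proof. by move=> fg; apply/fpsP => t; apply: (fg t.+1). Qed.

Lemma eqmodD T f f' g g' : eqmod T f f' -> eqmod T g g' -> eqmod T (f + g) (f' + g').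
Proof. by move=> ff gg t tT; rewrite !fcoefD ff ?gg. Qed.

Lemma eqmodB T f f' g g' : eqmod T f f' -> eqmod T g g' -> eqmod T (f - g) (f' - g').
Proof. by move=> ff gg t tT; rewrite !fcoefB ff ?gg. Qed.

Lemma eqmodM T f f' g g' : eqmod T f f' -> eqmod T g g' -> eqmod T (f * g) (f' * g').
Proof.
by move=> ff gg t tT; apply: eq_fcoefM => s st; [apply: ff | apply: gg];
  apply: leq_ltn_trans st tT.
Qed.

Lemma eqmodM0 T f g : eqmod T f 0 -> eqmod T (f * g) 0.
Proof. by move=> f0; rewrite -(mul0r g); apply: eqmodM. Qed.

Lemma eqmod_sum T n (f g : nat -> fps) :
  (forall m, (m < n)%N -> eqmod T (f m) (g m)) ->
  eqmod T (\sum_(m < n) f m) (\sum_(m < n) g m).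
Proof.
by move=> fg t tT; rewrite !fcoef_sum; apply: eq_bigr => m _; apply: fg.
Qed.

Lemma eqmodV T f g : f \is a GRing.unit -> g \is a GRing.unit ->
  eqmod T f g -> eqmod T f^-1 g^-1.
Proof.
move=> uf ug fg; have : eqmod T (f^-1 * g * g^-1) (f^-1 * f * g^-1).
  by apply: eqmodM => //; apply: eqmodM => //; apply: eqmod_sym.
by rewrite mulrK // mulVr // mul1r.
Qed.

Lemma eqmodqX T n f : (T <= n)%N -> eqmod T (q ^+ n * f) 0.
Proof.
move=> Tn; apply: eqmodM0 => t tT; rewrite fcoef_qX.
by rewrite ltn_eqF //; apply: leq_trans tT Tn.
Qed.

Lemma eqmod1BqX T n f : (T <= n)%N -> eqmod T (1 - q ^+ n * f) 1.
Proof. by move=> /(eqmodqX f); rewrite -[X in _ -> eqmod _ _ X]subr0; apply: eqmodB. Qed.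

(** A strong form of convergence: only the terms 0 to t can affect the coefficient of q^t, so
    [series_sum] may stop there. *)
Definition summable (f : nat -> fps) := forall n, eqmod n (f n) 0.

Definition series_sum (f : nat -> fps) := FPS (fun t => (\sum_(n < t.+1) f n) t).

Lemma series_sumP f T : summable f -> eqmod T (series_sum f) (\sum_(n < T) f n).
Proof.
move=> sf t tT /=; rewrite (big_ord_widen _ f tT) big_mkcond !fcoef_sum.
apply: eq_bigr => n _; case: ltnP => // nt; by rewrite [RHS]sf.
Qed.

Lemma series_sumD f g : series_sum (fun n => f n + g n) = series_sum f + series_sum g.
Proof. by apply/fpsP => t; rewrite /series_sum /= big_split. Qed.

Lemma series_sumZ c f : summable f -> c * series_sum f = series_sum (fun n => c * f n).
Proof.
move=> sf; have scf : summable (fun n => c * f n).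
  by move=> n; rewrite mulrC; apply: eqmodM0.
apply: eqmod_eq => T; apply: (eqmod_trans _ (eqmod_sym (series_sumP scf))).
by rewrite -mulr_sumr; apply: eqmodM => //; apply: series_sumP.
Qed.

Lemma series_sumS f : summable f -> series_sum f = f 0%N + series_sum (fun n => f n.+1).
Proof.
move=> sf; have sf1 : summable (fun n => f n.+1).
  by move=> n; apply: eqmodW (sf n.+1).
apply: eqmod_eq => T.
apply: (eqmod_trans _ (eqmodD (eqmod_refl _) (eqmod_sym (series_sumP sf1)))).
by apply: eqmodW (leqnSn T) _; rewrite -(big_ord_recl _ f); apply: series_sumP.
Qed.

Lemma eq_series_sum f g : f =1 g -> series_sum f = series_sum g.
Proof. by move=> fg; apply/fpsP => t /=; congr (fcoef _ _); apply: eq_bigr. Qed.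

(** The bound n + 1 fits factors such as 1 - q^(n+1): the coefficient of q^t is determined by the
    first t factors. *)
Definition multipliable (f : nat -> fps) := forall n, eqmod n.+1 (f n) 1.

Definition series_prod (f : nat -> fps) := FPS (fun t => (\prod_(n < t) f n) t).

Lemma series_prodP f n : multipliable f -> eqmod n.+1 (series_prod f) (\prod_(m < n) f m).
Proof.
move=> mf; elim: n => [|n IHn] t.
  by case: t.
rewrite ltnS leq_eqVlt => /predU1P[-> // | tn].
rewrite IHn // big_ord_recr /= -[LHS](congr1 (fun g : fps => g t) (mulr1 _)).
by apply: (eqmodM (T := n.+1)) => //; apply: eqmod_sym.
Qed.

Lemma eq_series_prod f g : f =1 g -> series_prod f = series_prod g.
Proof. by move=> fg; apply/fpsP => t /=; congr (fcoef _ _); apply: eq_bigr. Qed.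

Lemma multipliableM f g : multipliable f -> multipliable g ->
  multipliable (fun n => f n * g n).
Proof. by move=> mf mg n; rewrite -[1]mulr1; apply: eqmodM. Qed.

Lemma series_prodM f g : multipliable f -> multipliable g ->
  series_prod f * series_prod g = series_prod (fun n => f n * g n).
Proof.
move=> mf mg; apply: eqmod_eq => T; apply: eqmodW (leqnSn T) _.
apply: (eqmod_trans _ (eqmod_sym (series_prodP (multipliableM mf mg)))).
by rewrite big_split; apply: eqmodM; apply: series_prodP.
Qed.

Lemma unit_fps (f : fps) : f 0%N = 1 -> f \is a GRing.unit.
Proof. by rewrite unfold_in /= /fps_unit => ->; apply: unitr1. Qed.

Lemma series_prod_unit (f : nat -> fps) : series_prod f \is a GRing.unit.
Proof. by apply: unit_fps; rewrite /= big_ord0. Qed.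

(** In the triple product this recovers the n digits of precision that the Gaussian coefficient of
    index N - n lacks. *)
Lemma eqmod_qM T n (f g : fps) : eqmod T f g -> eqmod (n + T) (q ^+ n * f) (q ^+ n * g).
Proof.
move=> fg t tT; rewrite !fcoefM; apply: eq_bigr => s _; rewrite fcoef_qX.
by case: eqP => [sn | _]; rewrite ?mul0r // fg //; have := ltn_ord s; lia.
Qed.

Lemma multipliable1BqX (e : nat -> nat) :
  (forall n, (n < e n)%N) -> multipliable (fun n => 1 - q ^+ e n).
Proof. by move=> en n; rewrite -[q ^+ _]mulr1; apply: eqmod1BqX. Qed.

Lemma multipliable1DqX (e : nat -> nat) :
  (forall n, (n < e n)%N) -> multipliable (fun n => 1 + q ^+ e n).
Proof.
by move=> en n; have := eqmod1BqX (-1) (en n); rewrite mulrN1 opprK.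
Qed.

(** The limit of [finite_triple_product] at a = q^al, b = q^be. The Gaussian coefficient of index N
    - n agrees with 1/E only modulo q^(N-n+1), but it multiplies a term divisible by q^n, so the
    error vanishes modulo q^(N+1). *)
Lemma triple_product al be : (0 < al)%N -> (0 < be)%N ->
  series_prod (fun m => (1 - q ^+ (al + (al + be) * m)) * (1 - q ^+ (be + (al + be) * m))
    * (1 - q ^+ ((al + be) * m.+1))) =
  series_sum (fun n => (-1) ^+ n * q ^+ (al * 'C(n.+1, 2) + be * 'C(n, 2))
    * (1 - q ^+ (be * (2 * n).+1))).
Proof.
move=> al0 be0; set c := (al + be)%N; set theta := (X in series_sum X).
have m1 : multipliable (fun m => 1 - q ^+ (al + c * m)).
  by apply: multipliable1BqX => n; rewrite /c; nia.
have m2 : multipliable (fun m => 1 - q ^+ (be + c * m)).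
  by apply: multipliable1BqX => n; rewrite /c; nia.
have m3 : multipliable (fun m => 1 - q ^+ (c * m.+1)).
  by apply: multipliable1BqX => n; rewrite /c; nia.
rewrite -(series_prodM (multipliableM m1 m2) m3) -(series_prodM m1 m2).
set E := series_prod (fun m => 1 - q ^+ (c * m.+1)).
have uE : E \is a GRing.unit by apply: series_prod_unit.
have qpochE n : qpoch (q ^+ c) n = \prod_(m < n) (1 - q ^+ (c * m.+1)).
  by apply: eq_bigr => m _; rewrite -exprM.
have uqpoch n : qpoch (q ^+ c) n \is a GRing.unit.
  by apply: unit_fps; rewrite qpochE -(series_prodP m3) //= big_ord0.
have modE T n : (T <= n.+1)%N -> eqmod T (qpoch (q ^+ c) n) E.
  move=> Tn; apply: eqmodW Tn _; rewrite qpochE; exact/eqmod_sym/series_prodP.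
have bin_ge n : (n <= al * 'C(n.+1, 2) + be * 'C(n, 2))%N.
  by rewrite binS bin1; nia.
have thetaE n : theta n = q ^+ n * ((-1) ^+ n *
    q ^+ (al * 'C(n.+1, 2) + be * 'C(n, 2) - n) * (1 - q ^+ (be * (2 * n).+1))).
  by rewrite [in RHS]mulrA mulrCA -exprD subnKC.
have s_theta : summable theta by move=> n; rewrite thetaE; apply: eqmodqX.
have q0 : q != 0 by apply/eqP => /fpsP/(_ 1%N).
have fin N : \prod_(m < N) (1 - q ^+ (al + c * m)) * \prod_(m < N.+1) (1 - q ^+ (be + c * m))
    = \sum_(n < N.+1) gauss (q ^+ c) (N + N.+1) (N - n) * theta n.
  have := @finite_triple_product _ (q ^+ al) (q ^+ be) N.
  rewrite -exprD => F.
  under eq_bigr do rewrite exprD exprM.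
  under [X in _ * X]eq_bigr do rewrite exprD exprM.
  rewrite F ?expf_neq0 //; last first.
    by move=> n; apply/eqP => E0; have := uqpoch n; rewrite E0 unitr0.
  apply: eq_bigr => n _; congr (_ * (_ * _)); last by rewrite exprM.
  by rewrite exprD !exprM mulrA.
apply: eqmod_eq => T; apply: (eqmod_trans _ (eqmod_sym (series_sumP s_theta))).
case: T => // N.
apply: (eqmod_trans (eqmodM (eqmodM (series_prodP m1) (eqmodW _ (series_prodP (n := N.+1) m2))) (eqmod_refl E))) => //.
rewrite fin mulr_suml.
apply: (eqmod_sum (f := fun n => gauss (q ^+ c) (N + N.+1) (N - n) * theta n * E)) => n nN.
rewrite thetaE mulrAC mulrCA; apply: (eqmodW (T := n + (N - n).+1)); first by lia.
apply: eqmod_qM.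
rewrite -[X in eqmod _ _ X]mul1r; apply: eqmodM => //.
have := gauss_qpoch (q ^+ c) (N.+1 + n) (N - n).
have -> : (N.+1 + n + (N - n) = N + N.+1)%N by lia.
set g := gauss _ _ _ => gE.
(* All three q-products in [gE] have at least N - n factors, hence agree with E to this precision;
   one unit E is then divided out. *)
have EE : eqmod (N - n).+1 (g * E * E) (1 * E).
  rewrite mul1r -mulrA; apply: (eqmod_trans (g := qpoch (q ^+ c) (N + N.+1))); last first.
    by apply: modE; lia.
  by rewrite -gE; apply: eqmodM => //; apply: eqmodM; apply: eqmod_sym; apply: modE; lia.
by have := eqmodM EE (eqmod_refl E^-1); rewrite !mulrK.
Qed.

(** * Regrouping infinite products, and the theta series of G_i *)

Lemma eqmod_prod1 T n (f : nat -> fps) :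
  (forall m, (m < n)%N -> eqmod T (f m) 1) -> eqmod T (\prod_(m < n) f m) 1.
Proof.
elim: n => [|n IHn] f1; first by rewrite big_ord0.
rewrite big_ord_recr /= -[X in eqmod _ _ X]mulr1; apply: eqmodM; last exact: f1.
by apply: IHn => m mn; apply: f1; apply: ltnW.
Qed.

Lemma multipliable_regroup d f : (0 < d)%N -> multipliable f ->
  multipliable (fun s => \prod_(m < d) f (d * s + m)%N).
Proof.
move=> d0 mf s; apply: (eqmod_prod1 (f := fun m => f (d * s + m)%N)) => m _.
by apply: eqmodW (mf _); nia.
Qed.

Lemma series_prod_regroup d f : (0 < d)%N -> multipliable f ->
  series_prod f = series_prod (fun s => \prod_(m < d) f (d * s + m)%N).
Proof.
move=> d0 mf; have mg := multipliable_regroup d0 mf.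
apply: eqmod_eq => T; apply: eqmodW (leqnSn T) _.
apply: (eqmod_trans _ (eqmod_sym (series_prodP mg))).
have -> : \prod_(s < T) \prod_(m < d) f (d * s + m)%N = \prod_(m < d * T) f m.
  elim: T => [|T IHT]; first by rewrite muln0 !big_ord0.
  by rewrite big_ord_recr /= IHT mulnSr big_split_ord.
by apply: eqmodW (series_prodP mf); nia.
Qed.

Definition euler4 : fps := series_prod (fun m => if (m.+1 %% 4 != 2)%N then 1 - q ^+ m.+1 else 1).

Lemma multipliable_if (b : pred nat) f : multipliable f ->
  multipliable (fun n => if b n then f n else 1).
Proof. by move=> mf n; case: ifP => _ //; apply: mf. Qed.

Lemma multipliable1BqXS : multipliable (fun n => 1 - q ^+ n.+1).
Proof. exact: multipliable1BqX. Qed.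

(** Each odd m gives (1 - q^m)(1 + q^m) = 1 - q^(2m), which supplies the exponents 2 mod 4 absent
    from [euler4]. *)
Lemma euler4E : euler4 * series_prod (fun m => 1 + q ^+ (2 * m).+1) =
  series_prod (fun m => 1 - q ^+ (2 * m).+2).
Proof.
have mY : multipliable (fun m => 1 - q ^+ (4 * m + 2)) by apply: multipliable1BqX => n; lia.
have mD : multipliable (fun m => 1 + q ^+ (2 * m).+1) by apply: multipliable1DqX => n; lia.
have mP : multipliable (fun m => 1 - q ^+ (2 * m).+2) by apply: multipliable1BqX => n; lia.
have mF := multipliable_if (fun m => m.+1 %% 4 != 2)%N multipliable1BqXS.
(* In blocks of four exponents, the left side produces 1 - q^(8s+2) and 1 - q^(8s+6) where the right
   side has 1 - q^(4s+2). Multiplying by the product of all 1 - q^(4m+2), kept single on the left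
   and taken in pairs on the right, makes the identity hold block by block. *)
apply: (mulIr (series_prod_unit (fun m => 1 - q ^+ (4 * m + 2)))).
rewrite [in RHS](series_prod_regroup (d := 2) _ mY) // /euler4.
rewrite (series_prod_regroup (d := 4) _ mF) // (series_prod_regroup (d := 2) _ mD) //.
rewrite (series_prod_regroup (d := 2) _ mP) //.
have /= mF4 := multipliable_regroup (isT : 0 < 4)%N mF.
have /= mD2 := multipliable_regroup (isT : 0 < 2)%N mD.
have /= mP2 := multipliable_regroup (isT : 0 < 2)%N mP.
have /= mY2 := multipliable_regroup (isT : 0 < 2)%N mY.
rewrite (series_prodM mF4 mD2) (series_prodM (multipliableM mF4 mD2) mY) (series_prodM mP2 mY2).
apply: eq_series_prod => s; rewrite !big_ord_recr !big_ord0 /= !mul1r.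
have -> : ((4 * s + 0).+1 %% 4 != 2)%N by lia.
have -> : ((4 * s + 1).+1 %% 4 != 2)%N = false by lia.
have -> : ((4 * s + 2).+1 %% 4 != 2)%N by lia.
have -> : ((4 * s + 3).+1 %% 4 != 2)%N by lia.
rewrite mulr1.
set x := q ^+ (4 * s + 0).+1; set y := q ^+ (4 * s + 2).+1; set z := q ^+ (4 * s + 2).
have -> : q ^+ (2 * (2 * s + 0)).+1 = x by congr (_ ^+ _); lia.
have -> : q ^+ (2 * (2 * s + 1)).+1 = y by congr (_ ^+ _); lia.
have -> : q ^+ (2 * (2 * s + 0)).+2 = z by congr (_ ^+ _); lia.
have -> : q ^+ (2 * (2 * s + 1)).+2 = q ^+ (4 * s + 3).+1 by congr (_ ^+ _); lia.
have -> : q ^+ (4 * (2 * s + 0) + 2) = x * x by rewrite -exprD; congr (_ ^+ _); lia.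
have -> : q ^+ (4 * (2 * s + 1) + 2) = y * y by rewrite -exprD; congr (_ ^+ _); lia.
ring.
Qed.

Lemma big_mem_ord n (r : seq nat) (f : nat -> fps) : uniq r -> all (fun m => (m < n)%N) r ->
  \prod_(m < n | (m : nat) \in r) f m = \prod_(m <- r) f m.
Proof.
move=> ur rn; rewrite -(big_mkord (fun m => m \in r)) -big_filter.
apply/perm_big/uniq_perm; rewrite ?filter_uniq ?iota_uniq // => m.
rewrite mem_filter mem_index_iota /=.
by case: (boolP (m \in r)) => //= /(allP rn) ->.
Qed.

(** The listed m are those for which m + 1 is 2k - (2i+1), 2k + (2i+1) or 4k, the excluded residues
    modulo 4k. These are odd or divisible by 4, so the condition modulo 4 removes none of them. *)
Lemma notin_admissible k i s m : (i < k)%N -> (m < 4 * k)%N ->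
  ((4 * k * s + m).+1 %% 4 != 2)%N && ~~ admissible k i.+1 (4 * k * s + m).+1 =
  (m \in [:: (2 * (k - i) - 2)%N; (2 * k + 2 * i)%N; (4 * k).-1]).
Proof.
move=> ik mk.
have M4k : ((4 * k * s + m).+1 %% (4 * k) = m.+1 %% (4 * k))%N.
  by rewrite -addnS mulnC modnMDl.
have M4 : ((4 * k * s + m).+1 %% 4 = m.+1 %% 4)%N.
  by rewrite -addnS -!mulnA mulnC modnMDl.
rewrite /admissible M4 M4k !inE mod0n !negb_and !negbK (modn_small (isT : 2 < 4)%N).
have al_lt : (2 * k + (2 * i.+1 - 1) < 4 * k)%N by clear -ik; lia.
have be_lt : (2 * k - (2 * i.+1 - 1) < 4 * k)%N by clear -ik; lia.
rewrite (modn_small al_lt) (modn_small be_lt).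
have E0 : (m.+1 %% (4 * k) == 0)%N = (m == (4 * k).-1).
  have [-> | m4k] : (m = (4 * k).-1 \/ m.+1 < 4 * k)%N by clear -mk; lia.
    by rewrite prednK ?modnn ?eqxx //; clear -mk; lia.
  by rewrite modn_small //; apply/esym/negbTE; clear -m4k; lia.
have E1 c : (0 < c < 4 * k)%N -> (m.+1 %% (4 * k) == c)%N = (m == c.-1).
  move=> c4k; have [-> | m4k] : (m = (4 * k).-1 \/ m.+1 < 4 * k)%N by clear -mk; lia.
    by rewrite prednK ?modnn; clear -c4k; lia.
  by rewrite modn_small //; clear -c4k; lia.
have al_gt0 : (0 < 2 * k + (2 * i.+1 - 1))%N by clear; lia.
have be_gt0 : (0 < 2 * k - (2 * i.+1 - 1))%N by clear -ik; lia.
rewrite E0 !E1 ?al_gt0 ?be_gt0 //.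
have -> : ((2 * k + (2 * i.+1 - 1)).-1 = 2 * k + 2 * i)%N by clear -ik; lia.
have -> : ((2 * k - (2 * i.+1 - 1)).-1 = 2 * (k - i) - 2)%N by clear -ik; lia.
have : [|| m == 2 * (k - i) - 2, m == 2 * k + 2 * i | m == (4 * k).-1]%N -> (m.+1 %% 4 != 2)%N.
  clear -ik; case/or3P=> /eqP->.
  - have [d ->] : exists d, k = (i + d.+1)%N by exists (k - i).-1; lia.
    have -> : (2 * (i + d.+1 - i) - 2 = 2 * d)%N by lia.
    lia.
  - lia.
  - lia.
by case: (m == _); case: (m == _); case: (m == _);
   case: (m.+1 %% 4 == 2)%N => //= H; have := H isT.
Qed.

(** [euler4] cancels every factor of the product and leaves the 1 - q^m with m in the three excluded
    classes modulo 4k. This is the triple product for [al] and [be], whose sum is 4k. *)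
Lemma Gprod_euler4 k i : (i < k)%N ->
  Gprod k i.+1 * euler4 =
  series_sum (fun n => (-1) ^+ n * q ^+ (2 * k * n * n + (2 * i + 1) * n)
    * (1 - q ^+ ((2 * (k - i) - 1) * (2 * n).+1))).
Proof.
move=> ik; pose al := (2 * k + 2 * i + 1)%N; pose be := (2 * (k - i) - 1)%N.
have mF := multipliable_if (fun m => m.+1 %% 4 != 2)%N multipliable1BqXS.
have mG : multipliable (fun m => if admissible k i.+1 m.+1 then (1 - q ^+ m.+1)^-1 else 1).
  apply: (@multipliable_if (fun m => admissible k i.+1 m.+1)) => n.
  rewrite -[X in eqmod _ _ X]invr1; apply: eqmodV; rewrite ?unit_1BqX ?unitr1 //.
  exact: multipliable1BqXS.
have -> : Gprod k i.+1 = series_prod (fun m => if admissible k i.+1 m.+1 then (1 - q ^+ m.+1)^-1 else 1).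
  by apply/fpsP => t; rewrite /= /Gpartial big_mkcond big_add1 big_mkord.
pose w m := if (m.+1 %% 4 != 2)%N && ~~ admissible k i.+1 m.+1 then 1 - q ^+ m.+1 else 1.
have mw : multipliable w by apply: multipliable_if multipliable1BqXS.
rewrite series_prodM // (eq_series_prod (g := w)); last first.
  move=> m; rewrite /w; case: (boolP (admissible _ _ _)) => [|_]; last by rewrite mul1r andbT.
  by rewrite {1}/admissible => /and4P[-> _ _ _]; rewrite mulVr ?unit_1BqX.
rewrite (series_prod_regroup (d := 4 * k)) //; last by lia.
transitivity (series_prod (fun m => (1 - q ^+ (al + (al + be) * m)) * (1 - q ^+ (be + (al + be) * m))
    * (1 - q ^+ ((al + be) * m.+1)))); last first.
  rewrite triple_product; try by rewrite /al /be; lia.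
  apply: eq_series_sum => n; congr (_ * q ^+ _ * _).
  have := mulCbin2 n; rewrite binS bin1 /al /be => E.
  have [d ->] : exists d, k = (i + d.+1)%N by exists (k - i).-1; lia.
  rewrite -[(_ * n * n)%N]mulnA -E; have -> : (i + d.+1 - i = d.+1)%N by lia.
  have -> : (2 * d.+1 - 1 = 2 * d + 1)%N by lia.
  by lia.
apply: eq_series_prod => s; pose r := [:: be.-1; al.-1; (4 * k).-1].
have albe : (al + be = 4 * k)%N by rewrite /al /be; lia.
transitivity (\prod_(m < 4 * k | (m : nat) \in r) (1 - q ^+ (4 * k * s + m).+1)).
  rewrite [RHS]big_mkcond; apply: eq_bigr => m _; rewrite /w; congr (if _ then _ else _).
  rewrite notin_admissible //; congr (_ \in [:: _; _; _]); rewrite /be /al.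
  - by clear -ik; lia.
  - by clear; lia.
rewrite (big_mem_ord (fun m => 1 - q ^+ (4 * k * s + m).+1)); last first.
- by rewrite /= /al /be; clear -ik; lia.
- by rewrite /= !inE /al /be; clear -ik; lia.
rewrite !big_cons big_nil mulr1 albe mulrA [X in X * _ = _]mulrC.
congr ((1 - q ^+ _) * (1 - q ^+ _) * (1 - q ^+ _)); rewrite /al /be; clear -ik; nia.
Qed.

(** * Andrews' series *)

(** What remains of the infinite products in Andrews' n-th term after the normalization: (q^(2n+2);
    q^2)_j / (-q^(2n+1); q^2)_(j+1). *)
Definition qratio j n : fps :=
  \prod_(m < j) (1 - q ^+ (2 * (n + m)).+2) / \prod_(m < j.+1) (1 + q ^+ (2 * (n + m)).+1).

Lemma unit_1DqX n : 1 + q ^+ n.+1 \is a GRing.unit.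
Proof. by apply: unit_fps; rewrite fcoefD fcoef_qX. Qed.

Lemma unit_prod1DqX (e : nat -> nat) n : \prod_(m < n) (1 + q ^+ (e m).+1) \is a GRing.unit.
Proof. by apply: rpred_prod => m _; apply: unit_1DqX. Qed.

Lemma eq_divM (R : comUnitRingType) (a b c a' b' c' : R) :
  b \is a GRing.unit -> b' \is a GRing.unit -> a * c * b' = a' * c' * b ->
  a / b * c = a' / b' * c'.
Proof.
move=> ub ub' E; apply: (mulIr ub); apply: (mulIr ub').
transitivity (a / b * b * c * b'); first by ring.
by rewrite divrK // E -[in LHS](divrK ub' a'); ring.
Qed.

Lemma unit_qratio_den j n : \prod_(m < j) (1 + q ^+ (2 * (n + m)).+1) \is a GRing.unit.
Proof. exact: unit_prod1DqX (fun m => 2 * (n + m))%N j. Qed.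

(** This and [qratioSr] express the ratios of level j at n + 1 and at n through the same ratio of
    level j + 1, as the index shift in [Hser_sub] requires. *)
Lemma qratioSl j n : qratio j n.+1 * (1 - q ^+ (2 * n).+2) = qratio j.+1 n * (1 + q ^+ (2 * n).+1).
Proof.
apply: eq_divM; rewrite ?unit_qratio_den //.
have shift (F : nat -> fps) i : \prod_(m < i.+1) F (n + m)%N = F n * \prod_(m < i) F (n.+1 + m)%N.
  rewrite big_ord_recl /= addn0; congr (_ * _).
  by apply: eq_bigr => m _; rewrite /bump add1n addSnnS.
have /= -> := shift (fun m => 1 - q ^+ (2 * m).+2) j.
by have /= -> := shift (fun m => 1 + q ^+ (2 * m).+1) j.+1; ring.
Qed.

Lemma qratioSr j n : qratio j n * (1 - q ^+ (2 * (n + j)).+2) = qratio j.+1 n * (1 + q ^+ (2 * (n + j)).+3).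
Proof.
apply: eq_divM; rewrite ?unit_qratio_den //.
rewrite [in RHS]big_ord_recr [in LHS](big_ord_recr j.+1) /=.
have -> : ((2 * (n + j.+1)).+1 = (2 * (n + j)).+3)%N by lia.
ring.
Qed.

Lemma qratio0 n : qratio 0 n * (1 + q ^+ (2 * n).+1) = 1.
Proof. by rewrite /qratio big_ord0 big_ord1 mul1r addn0 mulVr ?unit_1DqX. Qed.

Definition Hterm j s t n : fps :=
  (-1) ^+ n * q ^+ (2 * (s + t) * n * (n + j) + n + 2 * t * n)
    * (1 - q ^+ (2 * s * (j + 1 + 2 * n))) * qratio j n.

(* [Hser j s t] and [Jser j s t] are Andrews' H_{s+t,s} and J_{s+t+1,s+1}, with base
   q^2 and a = -1/q, at x = q^(2j+2) and x = q^(2j), times (q^2;q^2)_oo / (-q;q^2)_oo.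
   Passing t instead of k keeps all exponents free of subtraction. *)
Definition Hser j s t := series_sum (Hterm j s t).

Definition Jser j s t := Hser j s.+1 t + q ^+ (2 * j).+1 * Hser j s t.+1.

Definition Jterm j s t n : fps :=
  (-1) ^+ n * q ^+ (2 * (s + t).+1 * n * (n + j) + n + 2 * t * n) * qratio j n
  * (1 + q ^+ (2 * (n + j)).+1
     - q ^+ (2 * s * (j + 1 + 2 * n) + 2 * n + (2 * j).+1) * (1 + q ^+ (2 * n).+1)).

Lemma summableqX (e : nat -> nat) f : (forall n, (n <= e n)%N) ->
  summable (fun n => q ^+ e n * f n).
Proof. by move=> en n; apply: eqmodqX. Qed.

Lemma eq_summable f g : f =1 g -> summable f -> summable g.
Proof. by move=> fg sf n; rewrite -fg. Qed.

Lemma summable_Hterm j s t : summable (Hterm j s t).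
Proof.
apply: eq_summable (@summableqX
  (fun n => 2 * (s + t) * n * (n + j) + n + 2 * t * n)%N
  (fun n => (-1) ^+ n * (1 - q ^+ (2 * s * (j + 1 + 2 * n))) * qratio j n) _).
  by move=> n; rewrite /Hterm !mulrA [_ * (-1) ^+ n]mulrC.
by move=> n; lia.
Qed.

Lemma JserE j s t : Jser j s t = series_sum (Jterm j s t).
Proof.
rewrite /Jser /Hser series_sumZ; last exact: summable_Hterm.
rewrite -series_sumD; apply: eq_series_sum => n; rewrite /Hterm /Jterm addSn (addnS s t).
set e := (2 * (s + t).+1 * n * (n + j) + n)%N.
set x := q ^+ (2 * s * (j + 1 + 2 * n)); set y := q ^+ (2 * n); set z := q ^+ (2 * j).
have -> : q ^+ (e + 2 * t.+1 * n) = q ^+ (e + 2 * t * n) * y.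
  by rewrite -exprD; congr (_ ^+ _); lia.
have -> : q ^+ (2 * s.+1 * (j + 1 + 2 * n)) = x * (z * y * y * q * q).
  by rewrite -!(exprD, exprSr); congr (_ ^+ _); lia.
have -> : q ^+ (2 * (n + j)).+1 = y * z * q.
  by rewrite -!(exprD, exprSr); congr (_ ^+ _); lia.
have -> : q ^+ (2 * s * (j + 1 + 2 * n) + 2 * n + (2 * j).+1) = x * y * z * q.
  by rewrite -!(exprD, exprSr); congr (_ ^+ _); lia.
have -> : q ^+ (2 * j).+1 = z * q by rewrite exprSr.
have -> : q ^+ (2 * n).+1 = y * q by rewrite exprSr.
ring.
Qed.

(** Andrews' relation H_{k,i} - H_{k,i-1} = x^(i-1) J_{k,k-i+1} for k = s + t + 1, i = s + 1, x =
    q^(2j+2). *)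
Lemma Hser_sub j s t : Hser j s.+1 t - Hser j s t.+1 = q ^+ (2 * j.+1 * s) * Jser j.+1 t s.
Proof.
(* With X = q^(2s(j+1+2n)), the difference of the n-th terms has the factor (1 - q^(2n)) + q^(2n) X
   (1 - q^(2(n+j)+2)); [u] and [v] carry its two parts. *)
pose u n := (-1) ^+ n * q ^+ (2 * (s + t).+1 * n * (n + j) + n + 2 * t * n) * qratio j n
  * (1 - q ^+ (2 * n)).
pose v n := (-1) ^+ n * q ^+ (2 * (s + t).+1 * n * (n + j) + n + 2 * t * n) * qratio j n
  * q ^+ (2 * n + 2 * s * (j + 1 + 2 * n)) * (1 - q ^+ (2 * (n + j)).+2).
have su : summable u.
  apply: eq_summable (@summableqX
    (fun n => 2 * (s + t).+1 * n * (n + j) + n + 2 * t * n)%N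
    (fun n => (-1) ^+ n * qratio j n * (1 - q ^+ (2 * n))) _).
    by move=> n; rewrite /u; ring.
  by move=> n; lia.
have -> : Hser j s.+1 t - Hser j s t.+1 = series_sum u + series_sum v.
  apply/eqP; rewrite subr_eq /Hser -!series_sumD; apply/eqP/eq_series_sum => n.
  rewrite /u /v /Hterm addSn (addnS s t).
  set e := (2 * (s + t).+1 * n * (n + j) + n)%N.
  set x := q ^+ (2 * s * (j + 1 + 2 * n)); set y := q ^+ (2 * n); set z := q ^+ (2 * j).
  have -> : q ^+ (e + 2 * t.+1 * n) = q ^+ (e + 2 * t * n) * y.
    by rewrite -exprD; congr (_ ^+ _); lia.
  have -> : q ^+ (2 * s.+1 * (j + 1 + 2 * n)) = x * (z * y * y * q * q).
    by rewrite -!(exprD, exprSr); congr (_ ^+ _); lia.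
  have -> : q ^+ (2 * (n + j)).+2 = y * z * q * q.
    by rewrite -!(exprD, exprSr); congr (_ ^+ _); lia.
  have -> : q ^+ (2 * n + 2 * s * (j + 1 + 2 * n)) = y * x by rewrite exprD.
  ring.
(* Since [u 0] vanishes, the first series can be shifted, and [u n.+1] is added to [v n] to form a
   term of level j + 1. *)
rewrite (series_sumS su) {1}/u muln0 subrr mulr0 add0r -series_sumD JserE series_sumZ.
  apply: eq_series_sum => n; rewrite /u /v /Jterm.
  transitivity ((-1) ^+ n.+1
       * q ^+ (2 * (s + t).+1 * n.+1 * (n.+1 + j) + n.+1 + 2 * t * n.+1)
       * (qratio j n.+1 * (1 - q ^+ (2 * n).+2))
    + (-1) ^+ n * q ^+ (2 * (s + t).+1 * n * (n + j) + n + 2 * t * n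
       + (2 * n + 2 * s * (j + 1 + 2 * n))) * (qratio j n * (1 - q ^+ (2 * (n + j)).+2))).
    congr (_ + _); last by rewrite [in RHS]exprD; ring.
    have -> : ((2 * n).+2 = 2 * n.+1)%N by lia.
    ring.
  rewrite qratioSl qratioSr.
  set e := (2 * (t + s).+1 * n * (n + j.+1) + n + 2 * s * n)%N.
  have -> : q ^+ (2 * (s + t).+1 * n.+1 * (n.+1 + j) + n.+1 + 2 * t * n.+1) =
      q ^+ (2 * j.+1 * s) * q ^+ e * q ^+ (2 * t * (j.+1 + 1 + 2 * n) + 2 * n + (2 * j.+1).+1).
    by rewrite -!exprD; congr (_ ^+ _); rewrite /e; lia.
  have -> : q ^+ (2 * (s + t).+1 * n * (n + j) + n + 2 * t * n
       + (2 * n + 2 * s * (j + 1 + 2 * n))) = q ^+ (2 * j.+1 * s) * q ^+ e.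
    by rewrite -!exprD; congr (_ ^+ _); rewrite /e; lia.
  have -> : ((2 * (n + j)).+3 = (2 * (n + j.+1)).+1)%N by lia.
  rewrite [(-1) ^+ n.+1]exprS; ring.
apply: eq_summable (@summableqX
  (fun n => 2 * (t + s).+1 * n * (n + j.+1) + n + 2 * s * n)%N
  (fun n => (-1) ^+ n * qratio j.+1 n * (1 + q ^+ (2 * (n + j.+1)).+1
     - q ^+ (2 * t * (j.+1 + 1 + 2 * n) + 2 * n + (2 * j.+1).+1) * (1 + q ^+ (2 * n).+1))) _).
  by move=> n; rewrite /Jterm; ring.
by move=> n; lia.
Qed.

Lemma series_sum_eqmod0 T f : (forall n, eqmod T (f n) 0) -> eqmod T (series_sum f) 0.
Proof.
by move=> f0 t tT; rewrite /= fcoef_sum big1 // => n _; apply: f0.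
Qed.

(** At j = 0 the bracket of [Jterm] is divisible by 1 + q^(2n+1), which cancels [qratio 0 n] and
    leaves the theta series of [Gprod_euler4]. *)
Lemma Jser0 s t : Jser 0 s t = Gprod (s + t).+1 t.+1 * euler4.
Proof.
rewrite Gprod_euler4; last by lia.
rewrite JserE; apply: eq_series_sum => n; rewrite /Jterm.
have -> : (2 * (s + t).+1 * n * (n + 0) + n + 2 * t * n =
  2 * (s + t).+1 * n * n + (2 * t + 1) * n)%N by lia.
rewrite -mulrA; congr (_ * _); rewrite addn0.
have -> : ((2 * ((s + t).+1 - t) - 1) * (2 * n).+1 =
    2 * s * (0 + 1 + 2 * n) + 2 * n + (2 * 0).+1)%N.
  have -> : ((s + t).+1 - t = s.+1)%N by lia.
  have -> : (2 * s.+1 - 1 = 2 * s + 1)%N by lia.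
  by lia.
by rewrite -[RHS]mul1r -[X in _ = X * _](qratio0 n); ring.
Qed.

Lemma Hser0 j t : Hser j 0 t = 0.
Proof.
apply: eqmod_eq => T; apply: series_sum_eqmod0 => n.
by rewrite /Hterm muln0 mul0n expr0 subrr mulr0 mul0r.
Qed.

(** [Hser_sub] applied to each of the two summands of [Jser]; this is the recursion of G cleared of
    its divisions. *)
Lemma Jser_step j s t : Jser j s.+1 t - Jser j s t.+1 =
  q ^+ (2 * j.+1 * s.+1) * Jser j.+1 t s.+1 + q ^+ (2 * j.+1 * s.+1).-1 * Jser j.+1 t.+1 s.
Proof.
have -> : (2 * j.+1 * s.+1).-1 = ((2 * j).+1 + 2 * j.+1 * s)%N by lia.
by rewrite exprD -[_ * _ * Jser _ _ _]mulrA -!Hser_sub /Jser; ring.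
Qed.

(** The counterpart of the double indexing (k-1)(j+1) + 1 = (k-1)j + k; it comes from H_{k,0} =
    0. *)
Lemma Jser_shift j t : Jser j 0 t = Jser j.+1 t 0.
Proof.
have := Hser_sub j 0 t; rewrite Hser0 subr0 muln0 expr0 mul1r => <-.
by rewrite /Jser Hser0 mulr0 addr0.
Qed.

(** Modulo q^j only the term n = 0 of the first H-series survives. It is congruent to [qratio j 0],
    a truncation of the quotient in [euler4E]. *)
Lemma Jser_lim j s : eqmod j (Jser j s 0) euler4.
Proof.
pose D := series_prod (fun m => 1 + q ^+ (2 * m).+1).
have uD : D \is a GRing.unit by apply: series_prod_unit.
have mD : multipliable (fun m => 1 + q ^+ (2 * m).+1) by apply: multipliable1DqX => n; lia.
have mP : multipliable (fun m => 1 - q ^+ (2 * m).+2) by apply: multipliable1BqX => n; lia.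
have -> : euler4 = series_prod (fun m => 1 - q ^+ (2 * m).+2) * D^-1.
  by rewrite -euler4E mulrK.
apply: (eqmod_trans (g := qratio j 0)); last first.
  apply: eqmodM; first exact: eqmodW (leqnSn j) (eqmod_sym (series_prodP mP)).
  apply: eqmodV => //; first exact: unit_qratio_den.
  by apply: eqmodW (eqmod_sym (series_prodP mD)); lia.
rewrite -[qratio j 0]addr0 /Jser; apply: eqmodD; last by apply: eqmodqX; lia.
rewrite /Hser (series_sumS (@summable_Hterm _ _ _)) -[qratio j 0]addr0; apply: eqmodD.
  rewrite -[X in eqmod _ _ X]mul1r /Hterm expr0 !muln0 mul1r; apply: eqmodM => //.
  rewrite mul1r -[q ^+ (2 * _ * _)]mulr1; apply: eqmod1BqX; lia.
have ge_nj n : (n + j <= 2 * (s.+1 + 0) * n.+1 * (n.+1 + j) + n.+1 + 2 * 0 * n.+1)%N by lia.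
have E n : Hterm j s.+1 0 n.+1 = q ^+ (2 * (s.+1 + 0) * n.+1 * (n.+1 + j) + n.+1 + 2 * 0 * n.+1)
    * ((-1) ^+ n.+1 * (1 - q ^+ (2 * s.+1 * (j + 1 + 2 * n.+1))) * qratio j n.+1).
  by rewrite /Hterm; ring.
rewrite (eq_series_sum E).
by apply: series_sum_eqmod0 => n; apply: eqmodqX; apply: leq_trans (ge_nj n); lia.
Qed.

(** [Jser_step] telescopes along s + t = K down to s = 0, where [Jser_shift] applies. *)
Lemma Jser_expand K j s t : (s + t = K)%N ->
  Jser j s t = \sum_(c < s.+1) q ^+ (2 * j.+1 * c) * Jser j.+1 (K - c) c
          + \sum_(c < s) q ^+ (2 * j.+1 * c.+1).-1 * Jser j.+1 (K - c) c.
Proof.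
elim: s t => [|s IHs] t st.
  by rewrite big_ord1 big_ord0 addr0 muln0 mul1r subn0 -st add0n Jser_shift.
rewrite big_ord_recr [X in _ + X]big_ord_recr /= addrACA -(IHs t.+1) ?addnS //.
have -> : (K - s.+1 = t)%N by lia.
have -> : (K - s = t.+1)%N by lia.
by rewrite -Jser_step addrC subrK.
Qed.

(** * The closed form of G and the matrix product *)

Definition Gser k j i : fps := Jser j (k.-1 - i) i / euler4.

Lemma unit_euler4 : euler4 \is a GRing.unit.
Proof. exact: series_prod_unit. Qed.

(** Row r of the matrix is [Jser_expand] at s = k - 1 - r: the ranges c < s + 1 and c < s of its two
    sums are the two bracket conditions, with r and c counted from 0. *)
Lemma Gser_expand k j (r : 'I_k) : Gser k j r = \sum_(c < k) A' k j.+1 r c * Gser k j.+1 c.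
Proof.
have rk := ltn_ord r.
rewrite /Gser (@Jser_expand k.-1); last by lia.
under [RHS]eq_bigr => c _ do rewrite mxE mulrA mulrDl.
rewrite -[RHS]mulr_suml big_split /=; congr ((_ + _) * _).
  have sk : ((k.-1 - r).+1 <= k)%N by lia.
  rewrite (big_ord_widen _ (fun c => q ^+ (2 * j.+1 * c) * Jser j.+1 (k.-1 - c) c) sk).
  rewrite big_mkcond; apply: eq_bigr => c _; have ck := ltn_ord c.
  have -> : (c.+1 <= k - r.+1 + 1)%N = (c < (k.-1 - r).+1)%N by clear -ck rk; lia.
  by case: ifP => _; rewrite ?mul0r // mul1r subSS subn0.
have sk : (k.-1 - r <= k)%N by lia.
rewrite (big_ord_widen _ (fun c => q ^+ (2 * j.+1 * c.+1).-1 * Jser j.+1 (k.-1 - c) c) sk).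
rewrite big_mkcond; apply: eq_bigr => c _; have ck := ltn_ord c.
have -> : (c.+1 <= k - r.+1)%N = (c < k.-1 - r)%N by clear -ck rk; lia.
by case: ifP => _; rewrite ?mul0r // mul1r subn1.
Qed.

Lemma divD_subK (F : fieldType) (y x a b : F) : y != 0 -> x != 0 ->
  (y * x * a + y * b) / (y * x) - x^-1 * b = a.
Proof. by move=> y0 x0; field; rewrite y0 x0. Qed.

(** Induction on j, then on i, along the recursion: [Jser0] settles j = 0, [Jser_shift] the first
    entry of a block and [Jser_step] the others. In particular all quotients lie in Z[[q]]. *)
Lemma Gblock_Gser k j i : (i < k)%N -> Gblock k j i.+1 = FracField.tofrac (Gser k j i).
Proof.
elim: j i => [|j IHj] i ik.
  rewrite /= /Gser Jser0; have -> : (k.-1 - i + i).+1 = k by lia.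
  by rewrite mulrK ?unit_euler4.
elim: i ik => [|i IHi] ik.
  have -> : Gblock k j.+1 1 = Gblock k j k.-1.+1 by rewrite prednK.
  rewrite IHj; last by lia.
  by rewrite /Gser subnn subn0 Jser_shift.
have -> : Gblock k j.+1 i.+2 = (Gblock k j (k - i.+2 + 1) - Gblock k j (k - i.+2 + 2))
    / qF ^+ (2 * j.+1 * (i.+2 - 1)) - qF^-1 * Gblock k j.+1 i.+1 by [].
rewrite IHi; last by lia.
have -> : (k - i.+2 + 1 = (k - i.+2).+1)%N by lia.
have -> : (k - i.+2 + 2 = (k - i.+2).+2)%N by lia.
rewrite !IHj; try lia.
set t := (k - i.+2)%N.
have qF0 : qF != 0.
  by rewrite tofrac_eq0; apply/eqP => /fpsP/(_ 1%N).
have E : Gser k j t - Gser k j t.+1 =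
    q ^+ (2 * j.+1 * i.+1) * Gser k j.+1 i.+1 + q ^+ (2 * j.+1 * i.+1).-1 * Gser k j.+1 i.
  rewrite /Gser -mulrBl !mulrA -mulrDl.
  have -> : (k.-1 - t = i.+1)%N by lia.
  have -> : (k.-1 - t.+1 = i)%N by lia.
  have -> : (k.-1 - i.+1 = t)%N by lia.
  have -> : (k.-1 - i = t.+1)%N by lia.
  by rewrite Jser_step.
rewrite -rmorphB E rmorphD !rmorphM !rmorphXn /= subn1 /=.
set m := (2 * j.+1 * i.+1)%N.
(* After division by q^m the second term of [E] becomes q^-1 times the preceding G, exactly what the
   recursion subtracts. *)
have -> : qF ^+ m = qF ^+ m.-1 * qF by rewrite -exprSr prednK // /m; lia.
by apply: divD_subK; rewrite ?expf_neq0.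
Qed.

(** This monoid structure lets the last factor of the iterated product [h] be split off. *)
HB.instance Definition _ (R : pzSemiRingType) n :=
  Monoid.isLaw.Build 'M[R]_n 1%:M (@mulmx R n n n)
    (@mulmxA R n n n n) (@mul1mx R n n) (@mulmx1 R n n).

Lemma h_recr k J0 j : (J0 <= j)%N -> h k J0 j.+1 = h k J0 j *m A' k j.+1.
Proof. by move=> Jj; rewrite /h big_nat_recr. Qed.

Lemma h_Gser k J0 j (r : 'I_k) : (J0 <= j)%N -> Gser k J0 r = \sum_(l < k) h k J0 j r l * Gser k j l.
Proof.
move=> /subnKC <-; elim: (j - J0)%N => [|d IHd].
  rewrite addn0 /h big_geq // (bigD1 r) //= mxE eqxx mul1r big1 ?addr0 // => l lr.
  by rewrite mxE eq_sym (negPf lr) mul0r.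
rewrite addnS h_recr ?leq_addr // IHd.
under eq_bigr => l _ do rewrite Gser_expand mulr_sumr.
rewrite exchange_big; apply: eq_bigr => c _ /=; rewrite mxE mulr_suml.
by apply: eq_bigr => l _; rewrite mulrA.
Qed.

(** The last factor alone suffices: in column l > 0, counted from 0, the entries of A'_(j) involve
    only the exponents 2jl and 2j(l+1) - 1, both at least j. The hypothesis J0 < j ensures that this
    factor is present. *)
Lemma h_col_eqmod0 k J0 j (r l : 'I_k) : (J0 < j)%N -> (0 < l)%N -> eqmod j (h k J0 j r l) 0.
Proof.
case: j => // j Jj l0; rewrite h_recr // mxE => t tj.
rewrite fcoef_sum big1 // => m _; move: t tj; rewrite -/(eqmod j.+1 _ 0) mulrC; apply: eqmodM0.
rewrite mxE -[0]addr0; apply: eqmodD; rewrite mulrC; apply: eqmodqX; rewrite ?subn1 /=; nia.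
Qed.

Lemma Gser_lim k j : (0 < k)%N -> eqmod j (Gser k j 0) 1.
Proof.
move=> k0; rewrite -(mulrV unit_euler4); apply: eqmodM => //; exact: Jser_lim.
Qed.

Theorem theorem5p2 (k : nat) (k_ge2 : (2 <= k)%N) (J : nat) (i : 'I_k) :
  exists2 L : fps,
    fps_cvg (fun j => h k J j i (Ordinal (ltnW k_ge2))) L
    & G k ((k - 1) * J + i.+1) = FracField.tofrac L.
Proof.
have ik := ltn_ord i; exists (Gser k J i); last by rewrite GblockE ?Gblock_Gser.
(* The bound makes j > t, so that working modulo q^j decides the coefficient of q^t, and j > J, so
   that the columns other than the first vanish modulo q^j. *)
set o := Ordinal _ => t; exists (maxn t J).+1 => j; rewrite gtn_max => /andP[tj Jj].
suff /(_ t tj) : eqmod j (h k J j i o) (Gser k J i) by [].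
rewrite (h_Gser _ (ltnW Jj)) (bigD1 o) //=.
(* In the expansion of [Gser k J i], the first column meets a series congruent to 1 and all other
   columns contribute 0. *)
apply: (eqmod_trans (g := h k J j i o * 1 + 0)); first by rewrite mulr1 addr0.
apply: eqmodD.
  apply: eqmodM => //; apply: eqmod_sym; apply: Gser_lim (ltnW k_ge2).
apply: eqmod_sym => s sj; rewrite fcoef_sum big1 // => l lo.
apply: (eqmodM0 (T := j)) => //; apply: h_col_eqmod0 => //.
by rewrite lt0n; apply: contraNneq lo => l0; apply/eqP/val_inj.
Qed.
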